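(* Let $\mathcal{T}$ be a countable directed poset and let $G:\mathcal{T}\to\mathrm{Grp}$ be a diagram of groups that satisfies the Mittag-Leffler condition. Then the natural map $$\mathrm{Ab}\Big(\lim_{t\in\mathcal{T}}G_t\Big)\longrightarrow\lim_{t\in\mathcal{T}}\mathrm{Ab}(G_t)$$ is surjective, and its kernel is a cotorsion group.
   Context: A poset $\mathcal{T}$ is viewed as a category with a single morphism $t\to s$ whenever $t\geq s$; so a diagram $G:\mathcal{T}\to\mathrm{Grp}$ (a functor to the category of groups) consists of groups $G_t$ and compatible homomorphisms $G_t\to G_s$ for $t\ge s$, and $\lim$ is the inverse limit. $\mathcal{T}$ is directed if for all $t,s\in\mathcal{T}$ there is $r\in\mathcal{T}$ with $r\geq t$ and $r\geq s$. Mittag-Leffler condition: for every $t\in\mathcal{T}$ there exists $s\geq t$ such that for every $r\geq s$ we have $\mathrm{Im}(G_s\to G_t)=\mathrm{Im}(G_r\to G_t)$. For a group $G$, $\mathrm{Ab}(G)=G/\mathrm{C}(G)$, where $\mathrm{C}(G)$ is the commutator subgroup (the subgroup generated by all commutators $[x,y]=x^{-1}y^{-1}xy$); $\mathrm{Ab}$ is a functor from groups to abelian groups. The natural map is the one induced by applying $\mathrm{Ab}$ to the projections $\lim_{t}G_t\to G_s$. An abelian group $A$ is cotorsion if $\mathrm{Ext}(\mathbb{Q},A)=0$, i.e. for every abelian group $B$ containing $A$ as a subgroup with $B/A\cong\mathbb{Q}$, $A$ is a direct summand of $B$. *)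

(* Defs.v *)
From HB Require Import structures.
From mathcomp Require Import all_boot all_order all_algebra.
From mathcomp Require Import boolp classical_sets functions cardinality.

Set Implicit Arguments.
Unset Strict Implicit.
Unset Printing Implicit Defensive.

Import Order.TTheory GRing.Theory.

Local Open Scope classical_set_scope.
Local Open Scope ring_scope.
Local Open Scope quotient_scope.

Definition directed d (T : porderType d) : Prop :=
  forall t s : T, exists r : T, (t <= r)%O /\ (s <= r)%O.

(* The arrow t -> s of the poset category exists exactly when s <= t; the order
   is boolean, so its proofs are irrelevant and there is at most one arrow. *)
Record grp_diagram d (T : porderType d) := GrpDiagram {
  grp_ob :> T -> groupType;
  grp_map : forall t s : T, (s <= t)%O ->
    UMagmaMorphism.type (grp_ob t) (grp_ob s);
  grp_map_id : forall (t : T) (tt : (t <= t)%O) (x : grp_ob t),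
    grp_map tt x = x;
  grp_map_comp : forall (t s r : T)
    (st : (s <= t)%O) (rs : (r <= s)%O) (rt : (r <= t)%O) (x : grp_ob t),
    grp_map rs (grp_map st x) = grp_map rt x
}.

Record ab_diagram d (T : porderType d) := AbDiagram {
  ab_ob :> T -> zmodType;
  ab_map : forall t s : T, (s <= t)%O -> {additive ab_ob t -> ab_ob s};
  ab_map_id : forall (t : T) (tt : (t <= t)%O) (x : ab_ob t), ab_map tt x = x;
  ab_map_comp : forall (t s r : T)
    (st : (s <= t)%O) (rs : (r <= s)%O) (rt : (r <= t)%O) (x : ab_ob t),
    ab_map rs (ab_map st x) = ab_map rt x
}.

Definition mittag_leffler d (T : porderType d) (G : grp_diagram T) : Prop :=
  forall t : T, exists (s : T) (ts : (t <= s)%O),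
    forall (r : T) (sr : (s <= r)%O),
      range (grp_map G ts) = range (grp_map G (le_trans ts sr)).

Record grp_lim d (T : porderType d) (G : grp_diagram T) := GrpLim {
  grp_lim_val : forall t : T, G t;
  grp_limP : forall (t s : T) (st : (s <= t)%O),
    grp_map G st (grp_lim_val t) = grp_lim_val s
}.

Section GrpLimGroup.
Variables (d : Order.disp_t) (T : porderType d) (G : grp_diagram T).
Implicit Types x y z : grp_lim G.

HB.instance Definition _ := gen_eqMixin (grp_lim G).
HB.instance Definition _ := gen_choiceMixin (grp_lim G).

Lemma grp_lim_ext x y : (forall t, grp_lim_val x t = grp_lim_val y t) -> x = y.
Proof.
case: x y => [x xP] [y yP] /= xy.
have {}xy : x = y by apply: functional_extensionality_dep.
by move: xP yP; rewrite xy => xP yP; congr GrpLim; apply: Prop_irrelevance.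
Qed.

Let one_subproof (t s : T) (st : (s <= t)%O) :
  grp_map G st (1%g : G t) = (1%g : G s).
Proof. exact: gmulf1. Qed.

Let mul_subproof x y (t s : T) (st : (s <= t)%O) :
  grp_map G st (grp_lim_val x t * grp_lim_val y t)%g
  = (grp_lim_val x s * grp_lim_val y s)%g.
Proof. by rewrite gmulfM !grp_limP. Qed.

Let inv_subproof x (t s : T) (st : (s <= t)%O) :
  grp_map G st (grp_lim_val x t)^-1%g = (grp_lim_val x s)^-1%g.
Proof. by rewrite gmulfV grp_limP. Qed.

Definition grp_lim_one : grp_lim G := GrpLim one_subproof.
Definition grp_lim_mul x y : grp_lim G := GrpLim (mul_subproof x y).
Definition grp_lim_inv x : grp_lim G := GrpLim (inv_subproof x).

Let mulgA : associative grp_lim_mul.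
Proof. by move=> x y z; apply: grp_lim_ext => t; exact: mulgA. Qed.
Let mul1g : left_id grp_lim_one grp_lim_mul.
Proof. by move=> x; apply: grp_lim_ext => t; exact: mul1g. Qed.
Let mulg1 : right_id grp_lim_one grp_lim_mul.
Proof. by move=> x; apply: grp_lim_ext => t; exact: mulg1. Qed.
Let mulVg : left_inverse grp_lim_one grp_lim_inv grp_lim_mul.
Proof. by move=> x; apply: grp_lim_ext => t; exact: mulVg. Qed.
Let mulgV : right_inverse grp_lim_one grp_lim_inv grp_lim_mul.
Proof. by move=> x; apply: grp_lim_ext => t; exact: mulgV. Qed.

HB.instance Definition _ :=
  isGroup.Build (grp_lim G) mulgA mul1g mulg1 mulVg mulgV.

Definition grp_proj (t : T) (x : grp_lim G) : G t := grp_lim_val x t.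

Let grp_projF (t : T) : {morph grp_proj t : x y / (x / y)%g}.
Proof. by []. Qed.
HB.instance Definition _ (t : T) :=
  isGroupMorphism.Build (grp_lim G) (G t) (grp_proj t) (@grp_projF t).

End GrpLimGroup.

Record ab_lim d (T : porderType d) (A : ab_diagram T) := AbLim {
  ab_lim_val : forall t : T, A t;
  ab_limP : forall (t s : T) (st : (s <= t)%O),
    ab_map A st (ab_lim_val t) = ab_lim_val s
}.

Section AbLimZmodule.
Variables (d : Order.disp_t) (T : porderType d) (A : ab_diagram T).
Implicit Types x y z : ab_lim A.

HB.instance Definition _ := gen_eqMixin (ab_lim A).
HB.instance Definition _ := gen_choiceMixin (ab_lim A).

Lemma ab_lim_ext x y : (forall t, ab_lim_val x t = ab_lim_val y t) -> x = y.
Proof.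
case: x y => [x xP] [y yP] /= xy.
have {}xy : x = y by apply: functional_extensionality_dep.
by move: xP yP; rewrite xy => xP yP; congr AbLim; apply: Prop_irrelevance.
Qed.

Let zero_subproof (t s : T) (st : (s <= t)%O) :
  ab_map A st (0 : A t) = (0 : A s).
Proof. exact: raddf0. Qed.

Let add_subproof x y (t s : T) (st : (s <= t)%O) :
  ab_map A st (ab_lim_val x t + ab_lim_val y t)
  = ab_lim_val x s + ab_lim_val y s.
Proof. by rewrite raddfD !ab_limP. Qed.

Let opp_subproof x (t s : T) (st : (s <= t)%O) :
  ab_map A st (- ab_lim_val x t) = - ab_lim_val x s.
Proof. by rewrite raddfN ab_limP. Qed.

Definition ab_lim_zero : ab_lim A := AbLim zero_subproof.
Definition ab_lim_add x y : ab_lim A := AbLim (add_subproof x y).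
Definition ab_lim_opp x : ab_lim A := AbLim (opp_subproof x).

Let addA : associative ab_lim_add.
Proof. by move=> x y z; apply: ab_lim_ext => t; exact: addrA. Qed.
Let addC : commutative ab_lim_add.
Proof. by move=> x y; apply: ab_lim_ext => t; exact: addrC. Qed.
Let add0 : left_id ab_lim_zero ab_lim_add.
Proof. by move=> x; apply: ab_lim_ext => t; exact: add0r. Qed.
Let addN : left_inverse ab_lim_zero ab_lim_opp ab_lim_add.
Proof. by move=> x; apply: ab_lim_ext => t; exact: addNr. Qed.

HB.instance Definition _ := GRing.isZmodule.Build (ab_lim A) addA addC add0 addN.

End AbLimZmodule.

Definition is_subgroup (G : groupType) (S : set G) : Prop :=
  S 1%g /\ forall x y : G, S x -> S y -> S (x / y)%g.

(* [~ x, y] is x^-1 * y^-1 * x * y. *)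
Definition commutator_subgroup (G : groupType) : set G :=
  smallest (@is_subgroup G) [set z | exists x y : G, z = [~ x, y]%g].

Section Abelianization.
Variable G : groupType.
Implicit Types x y z : G.
Local Notation C := (@commutator_subgroup G).

Lemma commutator_subgroup_is_subgroup : is_subgroup C.
Proof.
split=> [A [[A1 _] _] //|x y Cx Cy A AP].
by have [[_ AF] _] := AP; apply: AF; [exact: Cx | exact: Cy].
Qed.

Lemma commutator_subgroupR x y : C [~ x, y]%g.
Proof. by move=> A [_ AP]; apply: AP; exists x, y. Qed.

Lemma commutator_subgroup1 : C 1%g.
Proof. by have [] := commutator_subgroup_is_subgroup. Qed.

Lemma commutator_subgroupV x : C x -> C x^-1%g.
Proof.
have [C1 CF] := commutator_subgroup_is_subgroup.
by move=> Cx; rewrite -[(x^-1)%g]mul1g; exact: CF.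
Qed.

Lemma commutator_subgroupM x y : C x -> C y -> C (x * y)%g.
Proof.
have [C1 CF] := commutator_subgroup_is_subgroup.
by move=> Cx Cy; rewrite -[y]invgK; apply: CF => //; exact: commutator_subgroupV.
Qed.

Lemma commutator_subgroupJ x y : C x -> C (x ^ y)%g.
Proof.
move=> Cx; have -> : (x ^ y)%g = (x * [~ x, y])%g by rewrite commgEl mulVKg.
by apply: commutator_subgroupM => //; exact: commutator_subgroupR.
Qed.

Definition ab_equiv x y : bool := `[< C (x^-1 * y)%g >].

Lemma ab_equiv_is_equiv : equiv_class_of ab_equiv.
Proof.
split=> [x|x y|y x z].
- by apply/asboolP; rewrite mulVg; exact: commutator_subgroup1.
- by apply/asboolP/asboolP => /commutator_subgroupV; rewrite invgM invgK.
- move=> /asboolP xy /asboolP yz; apply/asboolP.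
  have -> : (x^-1 * z = (x^-1 * y) * (y^-1 * z))%g by rewrite -mulgA mulVKg.
  exact: commutator_subgroupM.
Qed.

Canonical ab_equiv_equiv := EquivRelPack ab_equiv_is_equiv.
Canonical ab_equiv_encModRel := defaultEncModRel ab_equiv.

Definition Ab : Type := {eq_quot ab_equiv}.

HB.instance Definition _ : EqQuotient G ab_equiv Ab := EqQuotient.on Ab.
HB.instance Definition _ := Choice.on Ab.

Lemma eq_Ab x y : (\pi_Ab x = \pi_Ab y) <-> C (x^-1 * y)%g.
Proof.
split=> [/eqP|Cxy]; first by rewrite piE => /asboolP.
by apply/eqP; rewrite piE; apply/asboolP.
Qed.

Lemma Ab_pi_mulr x y y' : \pi_Ab y = \pi_Ab y' ->
  \pi_Ab (x * y)%g = \pi_Ab (x * y')%g.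
Proof. by move/eq_Ab => Cy; apply/eq_Ab; rewrite invgM -mulgA mulKg. Qed.

Lemma Ab_pi_mulC x y : \pi_Ab (x * y)%g = \pi_Ab (y * x)%g.
Proof.
apply/eq_Ab; have -> : ((x * y)^-1 * (y * x) = [~ y, x])%g.
  by rewrite invgM /commg /conjg -!mulgA.
exact: commutator_subgroupR.
Qed.

Definition Ab_zero : Ab := \pi_Ab 1%g.
Definition Ab_add (u v : Ab) : Ab := \pi_Ab (repr u * repr v)%g.
Definition Ab_opp (u : Ab) : Ab := \pi_Ab (repr u)^-1%g.

Lemma Ab_addE x y : Ab_add (\pi_Ab x) (\pi_Ab y) = \pi_Ab (x * y)%g.
Proof.
rewrite /Ab_add (Ab_pi_mulr _ (reprK (\pi_Ab y))) Ab_pi_mulC.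
by rewrite (Ab_pi_mulr _ (reprK (\pi_Ab x))) Ab_pi_mulC.
Qed.

Lemma Ab_piP (u : Ab) : exists x, u = \pi_Ab x.
Proof. by exists (repr u); rewrite reprK. Qed.

Let addA : associative Ab_add.
Proof.
move=> u v w; have [x ->] := Ab_piP u; have [y ->] := Ab_piP v.
by have [z ->] := Ab_piP w; rewrite !Ab_addE mulgA.
Qed.
Let addC : commutative Ab_add.
Proof.
move=> u v; have [x ->] := Ab_piP u; have [y ->] := Ab_piP v.
by rewrite !Ab_addE Ab_pi_mulC.
Qed.
Let add0 : left_id Ab_zero Ab_add.
Proof. by move=> u; have [x ->] := Ab_piP u; rewrite Ab_addE mul1g. Qed.
Let addN : left_inverse Ab_zero Ab_opp Ab_add.
Proof.
by move=> u; rewrite /Ab_opp -[X in Ab_add _ X]reprK Ab_addE mulVg.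
Qed.

HB.instance Definition _ := GRing.isZmodule.Build Ab addA addC add0 addN.

Lemma Ab_piM x y : \pi_Ab (x * y)%g = \pi_Ab x + \pi_Ab y.
Proof. by rewrite -Ab_addE. Qed.

Lemma Ab_pi1 : \pi_Ab 1%g = 0.
Proof. by []. Qed.

End Abelianization.

Section AbFunctor.
Variables (G H : groupType) (f : UMagmaMorphism.type G H).

Lemma commutator_subgroup_map x :
  commutator_subgroup x -> commutator_subgroup (f x).
Proof.
move=> Cx; apply: (Cx (f @^-1` @commutator_subgroup H)).
have [C1 CF] := commutator_subgroup_is_subgroup H.
split => /=; last first.
  by move=> _ [y [z ->]] /=; rewrite gmulfR; exact: commutator_subgroupR.
by split=> [|y z Cy Cz] /=; [rewrite gmulf1 | rewrite gmulfF; exact: CF].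
Qed.

Definition Ab_map (u : Ab G) : Ab H := \pi_(Ab H) (f (repr u)).

Lemma Ab_mapE (x : G) : Ab_map (\pi_(Ab G) x) = \pi_(Ab H) (f x).
Proof.
have /eq_Ab/commutator_subgroup_map := reprK (\pi_(Ab G) x).
by rewrite gmulfM gmulfV => /eq_Ab.
Qed.

Let Ab_map_additive : nmod_morphism Ab_map.
Proof.
split=> [|u v]; first by rewrite -Ab_pi1 Ab_mapE gmulf1.
have [x ->] := Ab_piP u; have [y ->] := Ab_piP v.
by rewrite -Ab_piM !Ab_mapE gmulfM Ab_piM.
Qed.
HB.instance Definition _ :=
  GRing.isNmodMorphism.Build (Ab G) (Ab H) Ab_map Ab_map_additive.

End AbFunctor.

Section NaturalMap.
Variables (d : Order.disp_t) (T : porderType d) (G : grp_diagram T).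

Let Ab_diagram_id (t : T) (tt : (t <= t)%O) (u : Ab (G t)) :
  Ab_map (grp_map G tt) u = u.
Proof. by have [x ->] := Ab_piP u; rewrite Ab_mapE grp_map_id. Qed.

Let Ab_diagram_comp (t s r : T)
    (st : (s <= t)%O) (rs : (r <= s)%O) (rt : (r <= t)%O) (u : Ab (G t)) :
  Ab_map (grp_map G rs) (Ab_map (grp_map G st) u) = Ab_map (grp_map G rt) u.
Proof.
by have [x ->] := Ab_piP u; rewrite !Ab_mapE (grp_map_comp st rs rt).
Qed.

Definition Ab_diagram : ab_diagram T :=
  @AbDiagram d T (fun t => Ab (G t)) (fun t s st => Ab_map (grp_map G st))
    Ab_diagram_id Ab_diagram_comp.

Let natural_map_subproof (u : Ab (grp_lim G)) (t s : T) (st : (s <= t)%O) :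
  ab_map Ab_diagram st (Ab_map (@grp_proj d T G t) u)
  = Ab_map (@grp_proj d T G s) u.
Proof.
have [x ->] := Ab_piP u; rewrite /= !(Ab_mapE _ x) Ab_mapE.
by rewrite /= /grp_proj grp_limP.
Qed.

Definition natural_map (u : Ab (grp_lim G)) : ab_lim Ab_diagram :=
  @AbLim d T Ab_diagram (fun t => Ab_map (@grp_proj d T G t) u)
    (natural_map_subproof u).

Let natural_map_additive : nmod_morphism natural_map.
Proof.
by split=> [|u v]; apply: ab_lim_ext => t /=; rewrite ?raddf0 ?raddfD.
Qed.
HB.instance Definition _ :=
  GRing.isNmodMorphism.Build (Ab (grp_lim G)) (ab_lim Ab_diagram) natural_map
    natural_map_additive.

End NaturalMap.

Section KernelImage.
Variables (A B : zmodType) (f : {additive A -> B}).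

Definition in_kernel : {pred A} := [pred a | f a == 0].
Definition in_image : {pred B} := [pred b | `[< exists a : A, f a = b >]].

Let in_kernel_closed : zmod_closed in_kernel.
Proof.
split=> [|a b]; rewrite !inE ?raddf0 // => /eqP fa /eqP fb.
by rewrite raddfB fa fb subr0.
Qed.
HB.instance Definition _ := GRing.isZmodClosed.Build A in_kernel in_kernel_closed.

Let in_image_closed : zmod_closed in_image.
Proof.
split=> [|b c]; first by apply/asboolP; exists 0; exact: raddf0.
move=> /asboolP[a <-] /asboolP[a' <-]; apply/asboolP.
by exists (a - a'); exact: raddfB.
Qed.
HB.instance Definition _ := GRing.isZmodClosed.Build B in_image in_image_closed.

Definition kernel : Type := {a : A | in_kernel a}.
HB.instance Definition _ := SubChoice.on kernel.
HB.instance Definition _ := [SubChoice_isSubZmodule of kernel by <:].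

End KernelImage.

Definition direct_summand (B : zmodType) (A : zmodClosed B) : Prop :=
  exists C : zmodClosed B,
    (forall b : B, b \in A -> b \in C -> b = 0) /\
    (forall b : B, exists a c : B, [/\ a \in A, c \in C & b = a + c]).

(* A group B containing A is given by an embedding i : A -> B, and A is
   identified with its image in B. *)
Definition cotorsion (A : zmodType) : Prop :=
  forall (B : zmodType) (i : {additive A -> B}), injective i ->
    (exists phi : {additive Quotient.quot (in_image i) -> rat}, bijective phi) ->
    direct_summand (in_image i).

(* Main.v *)
(* Choose a cofinal sequence [t 0 <= t 1 <= ...] such that every [t n.+1]
   witnesses the Mittag-Leffler condition at [t n].  Then the image of
   [G (t n.+1)] in [G (t n)] lifts to [lim G], so the image of its commutator
   subgroup lifts to [C(lim G)].  Surjectivity follows by successive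
   approximation: correcting by elements of [C(lim G)] makes the approximations
   stationary at every level.
   A group [K] in which every system [x_n = a_n + (n+1) x_(n+1)] is solvable is
   cotorsion: a solution corrects lifts of [1/n!] so that they generate a
   complement isomorphic to [rat].  In the kernel, [a_n] has a representative
   in [lim G] that is trivial at level [t n], so the infinite expression
   [x_n = a_n (a_(n+1) (a_(n+2) ...)^(n+2))^(n+1)] converges in [lim G]. *)
From HB Require Import structures.
Require Import Defs.
From mathcomp Require Import all_boot all_order all_algebra.
From mathcomp Require Import boolp classical_sets functions cardinality.

Set Implicit Arguments.
Unset Strict Implicit.
Unset Printing Implicit Defensive.

Import Order.TTheory GRing.Theory Num.Theory.

Local Open Scope ring_scope.
Local Open Scope quotient_scope.

Lemma dependent_choice (X : nat -> Type) (R : forall n, X n -> X n.+1 -> Prop)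
    (x0 : X 0%N) :
  (forall n x, exists y, R n x y) ->
  exists f : forall n, X n, f 0%N = x0 /\ forall n, R n (f n) (f n.+1).
Proof.
move=> step; pose next n x := projT1 (cid (step n x)).
exists (nat_rect X x0 next); split=> // n /=.
exact: (projT2 (cid (step n _))).
Qed.

(** * Cofinal sequences witnessing the Mittag-Leffler condition *)

Section CofinalSequence.
Variables (d : Order.disp_t) (T : porderType d) (G : grp_diagram T).

Record ml_sequence (t : nat -> T) : Prop := MLSequence {
  ml_sequenceS : forall n, (t n <= t n.+1)%O;
  ml_sequence_cofinal : forall s, exists n, (s <= t n)%O;
  ml_sequence_stable : forall n (le_n : (t n <= t n.+1)%O) (r : T)
    (le_r : (t n <= r)%O) (x : G (t n.+1)), (t n.+1 <= r)%O ->
    exists y : G r, grp_map G le_r y = grp_map G le_n x }.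

Lemma ml_sequence_exists : T -> countable [set: T]%classic -> directed T ->
  mittag_leffler G -> exists t, ml_sequence t.
Proof.
move=> t0 /countable_injP[e e_inj] dirT mlG.
(* The element [s] with [e s = n] is dominated from stage [n.+1] on, which makes the sequence
   cofinal. *)
pose R (n : nat) (a b : T) := [/\ (a <= b)%O, forall s, e s = n -> (s <= b)%O &
  forall (ab : (a <= b)%O) (r : T) (ar : (a <= r)%O) (x : G b), (b <= r)%O ->
    exists y : G r, grp_map G ar y = grp_map G ab x].
have [|t [_ tR]] := @dependent_choice (fun=> T) R t0.
  move=> n a; have [s [as_ sP]] := mlG a.
  have [c cP] : exists c, forall s, e s = n -> (s <= c)%O.
    case: (pselect (exists c, e c = n)) => [[c ec]|nc]; last first.
      by exists a => s' es'; case: nc; exists s'.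
    by exists c => s' es'; rewrite (e_inj s' c) ?in_setT ?es'.
  have [b [sb cb]] := dirT s c; exists b; split.
  - exact: le_trans as_ sb.
  - by move=> s' /cP /le_trans; apply.
  move=> ab r ar x br.
  (* The image of [x] factors through the Mittag-Leffler witness [s] of [a], and [s] and [r] have
     the same image in [G a]. *)
  have xP : range (grp_map G as_) (grp_map G ab x).
    by exists (grp_map G sb x) => //; exact: grp_map_comp.
  move: xP; rewrite (sP r (le_trans sb br)) => -[y _ yx]; exists y.
  by rewrite -yx; congr (grp_map G _ y); exact: bool_irrelevance.
exists t; split=> [n|s|n]; first by have [] := tR n.
- by exists (e s).+1; have [_ + _] := tR (e s); apply.
- by move=> le_n r le_r x; have [_ _] := tR n; apply.
Qed.

(** Reduces lifting at level [n] to lifting at level [0]. With [n] as second summand, [0 + n] and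
    [k.+1 + n] compute, so no casts between groups arise. *)
Lemma ml_sequence_shift t n :
  ml_sequence t -> ml_sequence (fun k => t (k + n)%N).
Proof.
move=> [tS tcof tML]; split=> [k|s|k]; first exact: tS.
- have [m sm] := tcof s; exists m; apply: le_trans sm _.
  by apply: (homo_leq (@lexx _ T) (@le_trans _ T) tS); rewrite leq_addr.
- exact: tML.
Qed.

(** * The limit computed along the sequence *)

Section Limit.
Variables (t : nat -> T) (tP : ml_sequence t).
Local Notation L := (grp_lim G).
Local Notation tS := (ml_sequenceS tP).
Implicit Types (x y : L) (n j : nat).

Let t_le n m : (n <= m)%N -> (t n <= t m)%O.
Proof. exact: (homo_leq (@lexx _ T) (@le_trans _ T) tS). Qed.

Lemma grp_lim_of_sequence (z : forall n, G (t n)) :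
  (forall n, grp_map G (tS n) (z n.+1) = z n) ->
  exists x, forall n, grp_lim_val x (t n) = z n.
Proof.
move=> zS.
have z_le n k (le_nk : (t n <= t (k + n)%N)%O) :
    grp_map G le_nk (z (k + n)%N) = z n.
  elim: k le_nk => [|k IHk] le_nk; first exact: grp_map_id.
  rewrite -(IHk (t_le (leq_addl k n))) -(zS (k + n)%N).
  by rewrite (grp_map_comp _ _ le_nk).
pose N s := projT1 (cid (ml_sequence_cofinal tP s)).
have NP s : (s <= t (N s))%O := projT2 (cid (ml_sequence_cofinal tP s)).
(* Every [t m] above [s] induces the same coordinate at [s]: both sides come from index
   [N s + m]. *)
have zE s m (le_sm : (s <= t m)%O) :
    grp_map G le_sm (z m) = grp_map G (NP s) (z (N s)).
  rewrite -(z_le m (N s) (t_le (leq_addl _ _))).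
  have le_N : (t (N s) <= t (N s + m)%N)%O by apply: t_le; exact: leq_addr.
  have -> : z (N s) = grp_map G le_N (z (N s + m)%N).
    by move: le_N; rewrite addnC => le_N; rewrite z_le.
  by rewrite !(grp_map_comp _ _ (le_trans (NP s) le_N)).
have yP (a b : T) (ba : (b <= a)%O) :
    grp_map G ba (grp_map G (NP a) (z (N a))) = grp_map G (NP b) (z (N b)).
  by rewrite (grp_map_comp _ _ (le_trans ba (NP a))) zE.
exists (GrpLim yP) => n /=.
by rewrite -(zE _ n (lexx _)) grp_map_id.
Qed.

Lemma grp_lim_val_le x y (s r : T) : (r <= s)%O ->
  grp_lim_val x s = grp_lim_val y s -> grp_lim_val x r = grp_lim_val y r.
Proof. by move=> rs xy; rewrite -(grp_limP x rs) xy grp_limP. Qed.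

Lemma grp_lim_cauchy (y : nat -> L) :
  (forall n, grp_lim_val (y n) (t n) = grp_lim_val (y n.+1) (t n)) ->
  exists x, forall n, grp_lim_val x (t n) = grp_lim_val (y n) (t n).
Proof.
move=> yS; apply: (grp_lim_of_sequence (z := fun n => grp_lim_val (y n) (t n))).
by move=> n; rewrite grp_limP yS.
Qed.

(** Stability yields [w n.+1] agreeing with [w n] at level [n], but not necessarily at level [n.+1].
    Hence the compatible family consists of the images of the [w n] one level down. *)
Lemma grp_lim_lift0 (a : G (t 1%N)) :
  exists x, grp_lim_val x (t 0%N) = grp_map G (tS 0%N) a.
Proof.
pose R n (w : G (t n.+1)) (w' : G (t n.+2)) :=
  grp_map G (tS n) w = grp_map G (tS n) (grp_map G (tS n.+1) w').
have [|w [w0 wR]] := @dependent_choice (fun n => G (t n.+1)) R a.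
  move=> n w; have le_n : (t n <= t n.+2)%O by exact: le_trans (tS n) (tS n.+1).
  have [w' w'P] := ml_sequence_stable tP (tS n) le_n w (tS n.+1).
  by exists w'; rewrite /R (grp_map_comp _ _ le_n) w'P.
have [|x xP] := grp_lim_of_sequence (z := fun n => grp_map G (tS n) (w n)).
  by move=> n; rewrite -wR.
by exists x; rewrite xP w0.
Qed.

End Limit.

(** * Surjectivity and kernel of the natural map *)

Section LimitKernel.
Variables (t : nat -> T) (tP : ml_sequence t).
Local Notation L := (grp_lim G).
Local Notation tS := (ml_sequenceS tP).

Lemma grp_lim_lift n (a : G (t n.+1)) :
  exists x : L, grp_lim_val x (t n) = grp_map G (tS n) a.
Proof.
have [x xP] := grp_lim_lift0 (ml_sequence_shift n tP) a; exists x.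
by rewrite xP; congr (grp_map G _ a); exact: bool_irrelevance.
Qed.

(** The elements whose image lifts in this way form a subgroup. It contains every commutator, since
    the two entries lift separately. *)
Lemma commutator_lift n (a : G (t n.+1)) : commutator_subgroup a ->
  exists2 x : L, commutator_subgroup x &
    grp_lim_val x (t n) = grp_map G (tS n) a.
Proof.
move=> Ca; apply: (Ca (fun a => exists2 x : L, commutator_subgroup x &
    grp_lim_val x (t n) = grp_map G (tS n) a)).
have [C1 CF] := commutator_subgroup_is_subgroup L.
split; last first.
  move=> _ [b [c ->]]; have [x xP] := grp_lim_lift b.
  have [y yP] := grp_lim_lift c; exists [~ x, y]%g.
    exact: commutator_subgroupR.
  by rewrite gmulfR -xP -yP.
split; first by exists 1%g => //; rewrite gmulf1.
move=> b c [x Cx xP] [y Cy yP]; exists (x / y)%g; first exact: CF.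
by rewrite gmulfF -xP -yP.
Qed.

Lemma natural_map_piE (x : L) s :
  ab_lim_val (natural_map (\pi_(Ab L) x)) s = \pi_(Ab (G s)) (grp_lim_val x s).
Proof. exact: Ab_mapE. Qed.

Lemma natural_map_surjective (u : ab_lim (Ab_diagram G)) :
  exists x, natural_map x = u.
Proof.
have approx n : exists x : L,
    \pi_(Ab (G (t n))) (grp_lim_val x (t n)) = ab_lim_val u (t n).
  have [a aP] := Ab_piP (ab_lim_val u (t n.+1)).
  have [x xP] := grp_lim_lift a; exists x.
  by rewrite xP -(ab_limP u (tS n)) aP /= Ab_mapE.
(* [P] holds one level above the agreement asked by [R], because [commutator_lift] loses one
   level. *)
pose P n (x : L) :=
  \pi_(Ab (G (t n.+1))) (grp_lim_val x (t n.+1)) = ab_lim_val u (t n.+1).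
pose R n (x : {x | P n x}) (y : {y | P n.+1 y}) :=
  grp_lim_val (sval x) (t n) = grp_lim_val (sval y) (t n).
have [x0 x0P] := approx 1%N.
have [|y [_ yR]] := @dependent_choice _ R (exist (P 0%N) x0 x0P).
  move=> n [x xP]; have [v vP] := approx n.+2.
  have : \pi_(Ab (G (t n.+1))) (grp_lim_val v (t n.+1)) =
         \pi_(Ab (G (t n.+1))) (grp_lim_val x (t n.+1)).
    by rewrite xP -(ab_limP u (tS n.+1)) -vP /= Ab_mapE grp_limP.
  (* [c] lifts the image of [v^-1 * x], so [v * c] agrees with [x] at level [n] and has the class of
     [v]. *)
  move/eq_Ab/commutator_lift => [c Cc cP].
  have vcP : \pi_(Ab (G (t n.+2))) (grp_lim_val (v * c)%g (t n.+2)) =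
             ab_lim_val u (t n.+2).
    rewrite -natural_map_piE Ab_piM.
    have -> : \pi_(Ab L) c = 0.
      by rewrite -Ab_pi1; apply/esym/eq_Ab; rewrite invg1 mul1g.
    by rewrite addr0 natural_map_piE.
  exists (exist (P n.+1) _ vcP); rewrite /R /=.
  change (grp_lim_val x (t n) = grp_lim_val v (t n) * grp_lim_val c (t n))%g.
  by rewrite cP gmulfM gmulfV !grp_limP mulVKg.
have [x xP] := grp_lim_cauchy tP (y := fun n => sval (y n)) yR.
exists (\pi_(Ab L) x); apply: ab_lim_ext => s.
have [n sn] := ml_sequence_cofinal tP s.
have sn1 := le_trans sn (tS n).
rewrite natural_map_piE (grp_lim_val_le sn (xP n)).
by rewrite -(ab_limP u sn1) -(svalP (y n)) /= Ab_mapE grp_limP.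
Qed.

(** At [t n.+1] any representative lies in the commutator subgroup; dividing by a lift of its image
    kills the coordinate at [t n] and keeps the class. *)
Lemma trivial_representative n (u : Ab L) : natural_map u = 0 ->
  exists2 x : L, \pi_(Ab L) x = u & grp_lim_val x (t n) = 1%g.
Proof.
have [x ->] := Ab_piP u; move=> x0.
have : \pi_(Ab (G (t n.+1))) 1%g =
       \pi_(Ab (G (t n.+1))) (grp_lim_val x (t n.+1)).
  by rewrite -natural_map_piE x0.
move/eq_Ab; rewrite invg1 mul1g => /commutator_lift[c Cc cP].
exists (x / c)%g.
  by apply/eq_Ab; rewrite invgF -mulgA mulVg mulg1.
change ((grp_lim_val x (t n) / grp_lim_val c (t n)) = 1)%g.
by rewrite cP grp_limP mulgV.
Qed.

Lemma kernel_solvable (a : nat -> kernel (natural_map (G := G))) :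
  exists x : nat -> kernel (natural_map (G := G)),
    forall n, x n = a n + x n.+1 *+ n.+1.
Proof.
have /choice[b bP] n : exists x : L,
    \pi_(Ab L) x = val (a n) /\ grp_lim_val x (t n) = 1%g.
  have /eqP/(trivial_representative n)[x xa x1] := valP (a n).
  by exists x.
(* [e k n] keeps the first [k] factors of the infinite expression starting at [b n]. *)
pose fix e k n {struct k} : L :=
  if k is k'.+1 then (b n * e k' n.+1 ^+ n.+1)%g else 1%g.
have valX (x : L) m s : grp_lim_val (x ^+ m)%g s = (grp_lim_val x s ^+ m)%g.
  exact: (gmulfXn (@grp_proj d T G s)).
(* The extra innermost factor of [e k.+1 n] is [b (k + n)], which is trivial at this level. *)
have eS k n : grp_lim_val (e k n) (t (k + n)%N) =
              grp_lim_val (e k.+1 n) (t (k + n)%N).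
  elim: k n => [|k IHk] n.
    change (1 = grp_lim_val (b n) (t n) * grp_lim_val (1 ^+ n.+1) (t n))%g.
    by rewrite (bP n).2 expg1n mul1g.
  change (grp_lim_val (b n) (t (k.+1 + n)) *
            grp_lim_val (e k n.+1 ^+ n.+1) (t (k.+1 + n)) =
          grp_lim_val (b n) (t (k.+1 + n)) *
            grp_lim_val (e k.+1 n.+1 ^+ n.+1) (t (k.+1 + n)))%g.
  by rewrite !valX addSnnS IHk.
have e_le k n : grp_lim_val (e k n) (t k) = grp_lim_val (e k.+1 n) (t k).
  apply: grp_lim_val_le (eS k n).
  by apply: (homo_leq (@lexx _ T) (@le_trans _ T) tS); exact: leq_addr.
have /choice[x xP] n := grp_lim_cauchy tP (e_le^~ n).
have xE n : x n = (b n * x n.+1 ^+ n.+1)%g.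
  apply: grp_lim_ext => s; have [k sk] := ml_sequence_cofinal tP s.
  apply: (grp_lim_val_le sk); rewrite xP e_le.
  change (grp_lim_val (b n) (t k) * grp_lim_val (e k n.+1 ^+ n.+1) (t k) =
          grp_lim_val (b n) (t k) * grp_lim_val (x n.+1 ^+ n.+1) (t k))%g.
  by rewrite !valX xP.
have piX (y : L) m : \pi_(Ab L) (y ^+ m)%g = \pi_(Ab L) y *+ m.
  by elim: m => [|m IHm]; rewrite ?expg0 // expgS Ab_piM IHm mulrS.
have ek k n : natural_map (\pi_(Ab L) (e k n)) = 0.
  elim: k n => [|k IHk] n /=; first exact: raddf0.
  rewrite Ab_piM piX raddfD raddfMn [X in X *+ _]IHk mul0rn addr0 (bP n).1.
  exact/eqP/(valP (a n)).
(* At level [t k], [x n] agrees with [e k n], whose class is in the kernel. *)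
have xk n : in_kernel (natural_map (G := G)) (\pi_(Ab L) (x n)).
  suff /eqP : natural_map (\pi_(Ab L) (x n)) = 0 by []; apply: ab_lim_ext => s.
  have [k sk] := ml_sequence_cofinal tP s.
  by rewrite natural_map_piE (grp_lim_val_le sk (xP n k)) -natural_map_piE ek.
exists (fun n => exist (in_kernel _) _ (xk n)) => n; apply: val_inj.
by rewrite raddfD raddfMn /= {1}xE Ab_piM piX (bP n).1.
Qed.

End LimitKernel.
End CofinalSequence.

(** * A criterion for cotorsion *)

Lemma cotorsion_of_solvable (K : zmodType) :
  (forall a : nat -> K, exists x : nat -> K,
     forall n, x n = a n + x n.+1 *+ n.+1) ->
  cotorsion K.
Proof.
move=> solv B i i_inj [phi phi_bij].
pose psi : {additive B -> rat} := phi \o \pi_(Quotient.quot (in_image i)).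
have psi0 b : (psi b == 0) = (b \in in_image i).
  rewrite -[b in RHS]subr0 Quotient.idealrBE -(inj_eq (bij_inj phi_bij)).
  by congr (_ == _); exact: (esym (raddf0 psi)).
have psi_i k : psi (i k) = 0.
  by apply/eqP; rewrite psi0; apply/asboolP; exists k.
have fact_unit n : n`!%:R != 0 :> rat by rewrite pnatr_eq0 -lt0n fact_gt0.
have /choice[b bP] n : exists b, psi b = n`!%:R^-1.
  case: phi_bij => g _ gK; exists (repr (g n`!%:R^-1)).
  by rewrite /psi /= reprK gK.
(* Both terms have value [1/n!] under [psi], so the difference lies in the image of [i]. *)
have /choice[a aP] n : exists k, i k = b n - b n.+1 *+ n.+1.
  apply/asboolP; rewrite -[asbool _]/(_ \in in_image i) -psi0.
  rewrite raddfB raddfMn !bP subr_eq0 factS natrM invfM.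
  rewrite -[_ *+ n.+1]mulr_natl mulrA.
  by rewrite mulfV ?mul1r // pnatr_eq0.
have [x xP] := solv a.
pose c n := b n - i (x n).
have cS n : c n = c n.+1 *+ n.+1.
  by rewrite /c xP raddfD raddfMn aP mulrnBl opprD addrA subKr.
have psi_c n : psi (c n) = n`!%:R^-1 by rewrite raddfB psi_i subr0.
have c_le n k : exists m : nat, c n = c (n + k)%N *+ m.
  elim: k => [|k [m IHk]]; first by exists 1%N; rewrite addn0.
  by exists ((n + k).+1 * m)%N; rewrite IHk [in LHS]cS addnS mulrnA.
(* The cyclic groups generated by the [c n] increase with [n], so their union is a subgroup. *)
pose C : {pred B} := fun y => `[< exists n (m : int), y = c n *~ m >].
have C_closed : zmod_closed C.
  split=> [|_ _ /asboolP[n [m ->]] /asboolP[n' [m' ->]]].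
    by apply/asboolP; exists 0%N, 0.
  apply/asboolP; exists (n + n')%N.
  have [k ->] := c_le n n'; have [k' ->] := c_le n' n.
  exists (k%:Z * m - k'%:Z * m'); rewrite (addnC n') mulrzBr.
  by rewrite !mulrzA.
pose CM := GRing.isZmodClosed.Build B C C_closed.
pose CC : zmodClosed B := HB.pack C CM.
(* The value of [c n *~ m] under [psi] is [m/n!], which vanishes only for [m = 0]. *)
exists CC; split=> [y yA /asboolP[n [m ym]]|y].
  move: yA; rewrite ym -psi0 raddfMz psi_c -mulrzl mulf_eq0 invr_eq0.
  by rewrite (negPf (fact_unit n)) orbF intr_eq0 => /eqP->.
pose q := psi y; pose n := `|denq q|%N.
have [m qE] : exists m : int, q = psi (c n *~ m).
  (* As [n] is the denominator of [q], the fraction is expanded by [(n-1)!] to reach the denominator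
     [n!]. *)
  exists (numq q * (n.-1)`!%:Z); rewrite raddfMz psi_c -mulrzl.
  have n_gt0 : (0 < n)%N by rewrite absz_gt0 denq_neq0.
  have {2}<- : n.-1.+1 = n by rewrite prednK.
  rewrite factS prednK // natrM invfM rmorphM /= -[in LHS](divq_num_den q).
  rewrite mulrACA (mulfV (fact_unit _)) mulr1.
  by rewrite /n -[X in _ / X%:~R]gez0_abs.
exists (y - c n *~ m), (c n *~ m); split; last by rewrite subrK.
  by rewrite -psi0 raddfB -qE subrr.
by apply/asboolP; exists n, m.
Qed.

Theorem theorem0p0p1 (d : Order.disp_t) (T : porderType d) (G : grp_diagram T)
  (T_countable : countable [set: T]%classic)
  (T_directed : directed T)
  (G_ML : mittag_leffler G) :
  (forall y : ab_lim (Ab_diagram G),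
     exists x : Ab (grp_lim G), natural_map x = y) /\
  cotorsion (kernel (natural_map (G := G))).
Proof.
have [[t0]|noT] := pselect (inhabited T).
  have [t tP] := ml_sequence_exists t0 T_countable T_directed G_ML.
  split; first exact: (natural_map_surjective tP).
  apply: cotorsion_of_solvable; exact: (kernel_solvable tP).
(* The empty poset is directed in the stated sense; the limit over it is the trivial group. *)
have Ab0 (u : Ab (grp_lim G)) : u = 0.
  have [x ->] := Ab_piP u; rewrite -Ab_pi1; congr (\pi_(Ab (grp_lim G)) _).
  by apply: grp_lim_ext => s; case: noT.
split=> [y|].
  by exists 0; apply: ab_lim_ext => s; case: noT.
apply: cotorsion_of_solvable => a; exists (fun=> 0) => n.
by apply: val_inj; rewrite [LHS]Ab0 [RHS]Ab0.
Qed.
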